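(* Consider on $\mathbb R^4$ (coordinates $x,y,z,w$) the flat Engel sub-Lorentzian structure, i.e. the structure $(H,g)$ with orthonormal frame $$X=\frac{\partial}{\partial x}+\frac12y\frac{\partial}{\partial z}+\frac12y^2\frac{\partial}{\partial w},\qquad Y=\frac{\partial}{\partial y}-\frac12x\frac{\partial}{\partial z}-\frac12xy\frac{\partial}{\partial w}$$ and time orientation $X$, and let $J^+(0)$ be the reachable set from $0$. Define $$\hat f_1=z-\tfrac14(x^2-y^2),\qquad \hat f_2=-z-\tfrac14(x^2-y^2),$$ $$\hat g_1=w-\tfrac1{16}(x^2-y^2)(x+3y),\qquad \hat g_2=w-\tfrac1{16}(x^2-y^2)(x-3y),$$ $$\hat g_3=-w-\tfrac14(xy^2-y^3),\qquad \hat g_4=-w-\tfrac14(xy^2+y^3),$$ and $$A_{11}=\{\hat f_1\le0,\ \hat g_1\le0,\ x\ge0,\ y\ge0,\ z\ge0,\ w\ge0\},$$ $$A_{12}=\{\hat f_1\le0,\ \hat g_2\le0,\ x\ge0,\ y\le0,\ z\ge0,\ w\ge0\},$$ $$A_{13}=\{\hat f_1\le0,\ \hat g_3\le0,\ x\ge0,\ y\ge0,\ z\ge0,\ w\le0\},$$ $$A_{14}=\{\hat f_1\le0,\ \hat g_4\le0,\ x\ge0,\ y\le0,\ z\ge0,\ w\le0\},$$ $$A_{21}=\{\hat f_2\le0,\ \hat g_1\le0,\ x\ge0,\ y\ge0,\ z\le0,\ w\ge0\},$$ $$A_{22}=\{\hat f_2\le0,\ \hat g_2\le0,\ x\ge0,\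 y\le0,\ z\le0,\ w\ge0\},$$ $$A_{23}=\{\hat f_2\le0,\ \hat g_3\le0,\ x\ge0,\ y\ge0,\ z\le0,\ w\le0\},$$ $$A_{24}=\{\hat f_2\le0,\ \hat g_4\le0,\ x\ge0,\ y\le0,\ z\le0,\ w\le0\}.$$ Then $$J^+(0)\subset\bigcup_{i=1,2}\ \bigcup_{j=1,\dots,4}A_{ij}.$$
   Context: Here $H=\mathrm{Span}\{X,Y\}$ and $g$ is the Lorentzian metric on $H$ with $g(X,X)=-1$, $g(Y,Y)=1$, $g(X,Y)=0$. A vector $v\in H_q$ is nonspacelike if $g(v,v)\le0$ and $v\ne0$, and a nonspacelike $v$ is future directed if $g(v,X(q))<0$. A nonspacelike future directed curve is an absolutely continuous curve $\gamma$ with $\dot\gamma(t)\in H_{\gamma(t)}$ nonspacelike and future directed for a.e. $t$. The reachable set $J^+(0)$ is the set of all points of $\mathbb R^4$ that can be reached from $0$ by a nonspacelike future directed curve (the point $0$ itself may be included). *)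

(* Defs.v *)
From HB Require Import structures.
From mathcomp Require Import all_boot all_order all_algebra.
From mathcomp Require Import ring.
From mathcomp Require Import all_classical all_reals all_analysis.

Set Implicit Arguments.
Unset Strict Implicit.
Unset Printing Implicit Defensive.

Import Order.TTheory GRing.Theory Num.Theory.
Import numFieldNormedType.Exports.

Local Open Scope classical_set_scope.
Local Open Scope ring_scope.

(* Absolute continuity on [a, b]; it does not depend on the choice of the norm
   on the finite-dimensional space V, nor on the values of f outside [a, b]. *)
Definition abs_continuous (R : realType) (V : normedModType R)
    (a b : R) (f : R -> V) : Prop :=
  forall e : R, 0 < e -> exists2 d : R, 0 < d &
    forall (n : nat) (s t : 'I_n -> R),
      (forall i, a <= s i /\ s i <= t i /\ t i <= b) ->
      trivIset [set: 'I_n] (fun i => `]s i, t i[%classic) ->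
      \sum_(i < n) (t i - s i) < d ->
      \sum_(i < n) `|f (t i) - f (s i)| < e.

Section Engel.
Context {R : realType}.

Implicit Types (p v u : 'rV[R]_4) (q : 'rV[R]_4).

Definition cx q : R := q 0 0.
Definition cy q : R := q 0 1.
Definition cz q : R := q 0 2.
Definition cw q : R := q 0 3.

(* Tangent vectors are given by their components in the basis
   d/dx, d/dy, d/dz, d/dw. *)
Definition mkvec (x y z w : R) : 'rV[R]_4 := \row_(i < 4) [:: x; y; z; w]`_i.

Definition engelX q : 'rV[R]_4 :=
  mkvec 1 0 (1 / 2 * cy q) (1 / 2 * cy q ^+ 2).

Definition engelY q : 'rV[R]_4 :=
  mkvec 0 1 (- (1 / 2 * cx q)) (- (1 / 2 * cx q * cy q)).

Definition engelH q : set 'rV[R]_4 :=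
  [set v | exists a b : R, v = a *: engelX q + b *: engelY q].

(* The first two components of a X + b Y are a and b, so on engelH q this is
   the metric with g(X,X) = -1, g(Y,Y) = 1, g(X,Y) = 0: see engelgE.
   Only its restriction to engelH q is meaningful. *)
Definition engelg q u v : R := - (cx u * cx v) + cy u * cy v.

Definition nonspacelike q v : Prop :=
  [/\ engelH q v, engelg q v v <= 0 & v != 0].

Definition future_directed q v : Prop := engelg q v (engelX q) < 0.

Definition nonspacelike_fd_curve (a b : R) (c : R -> 'rV[R]_4) : Prop :=
  abs_continuous a b c /\
  {ae lebesgue_measure, forall t : R, a < t < b ->
     [/\ derivable c t 1,
         nonspacelike (c t) ('D_1 c t) &
         future_directed (c t) ('D_1 c t)]}.

Definition Jplus p : set 'rV[R]_4 :=
  [set q | q = p \/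
     exists (a b : R) (c : R -> 'rV[R]_4),
       [/\ a < b, nonspacelike_fd_curve a b c, c a = p & c b = q]].

Lemma engelgE q (a b a' b' : R) :
  engelg q (a *: engelX q + b *: engelY q) (a' *: engelX q + b' *: engelY q)
  = - (a * a') + b * b'.
Proof. by rewrite /engelg /cx /cy !mxE /=; ring. Qed.

Definition f1 q : R := cz q - 1 / 4 * (cx q ^+ 2 - cy q ^+ 2).
Definition f2 q : R := - cz q - 1 / 4 * (cx q ^+ 2 - cy q ^+ 2).
Definition g1 q : R :=
  cw q - 1 / 16 * (cx q ^+ 2 - cy q ^+ 2) * (cx q + 3 * cy q).
Definition g2 q : R :=
  cw q - 1 / 16 * (cx q ^+ 2 - cy q ^+ 2) * (cx q - 3 * cy q).
Definition g3 q : R := - cw q - 1 / 4 * (cx q * cy q ^+ 2 - cy q ^+ 3).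
Definition g4 q : R := - cw q - 1 / 4 * (cx q * cy q ^+ 2 + cy q ^+ 3).

Definition A11 : set 'rV[R]_4 := [set q |
  [/\ f1 q <= 0, g1 q <= 0 & [/\ 0 <= cx q, 0 <= cy q, 0 <= cz q & 0 <= cw q]]].
Definition A12 : set 'rV[R]_4 := [set q |
  [/\ f1 q <= 0, g2 q <= 0 & [/\ 0 <= cx q, cy q <= 0, 0 <= cz q & 0 <= cw q]]].
Definition A13 : set 'rV[R]_4 := [set q |
  [/\ f1 q <= 0, g3 q <= 0 & [/\ 0 <= cx q, 0 <= cy q, 0 <= cz q & cw q <= 0]]].
Definition A14 : set 'rV[R]_4 := [set q |
  [/\ f1 q <= 0, g4 q <= 0 & [/\ 0 <= cx q, cy q <= 0, 0 <= cz q & cw q <= 0]]].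
Definition A21 : set 'rV[R]_4 := [set q |
  [/\ f2 q <= 0, g1 q <= 0 & [/\ 0 <= cx q, 0 <= cy q, cz q <= 0 & 0 <= cw q]]].
Definition A22 : set 'rV[R]_4 := [set q |
  [/\ f2 q <= 0, g2 q <= 0 & [/\ 0 <= cx q, cy q <= 0, cz q <= 0 & 0 <= cw q]]].
Definition A23 : set 'rV[R]_4 := [set q |
  [/\ f2 q <= 0, g3 q <= 0 & [/\ 0 <= cx q, 0 <= cy q, cz q <= 0 & cw q <= 0]]].
Definition A24 : set 'rV[R]_4 := [set q |
  [/\ f2 q <= 0, g4 q <= 0 & [/\ 0 <= cx q, cy q <= 0, cz q <= 0 & cw q <= 0]]].

End Engel.

(* Main.v *)
(* Along a curve with velocity [u X + v Y], [u >= |v|], each of the functions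
   [-x - y], [-x + y], [f1], [f2], [g3], [g4] and
   [w - (x^2 - y^2) (x + 3 |y|) / 16] (which is [g1] for [y >= 0] and [g2] for
   [y <= 0]) is nonincreasing, and all vanish at the origin.  Up to a positive
   constant factor,
     f1' = - (u + v) (x - y),           f2' = - (u - v) (x + y),
     g3' = - (u - v) y^2,               g4' = - (u + v) y^2,
     g1' = - (u + v) (x - y) (x + 3 y), g2' = - (u - v) (x + y) (x - 3 y),
   and [x >= |y|].  Since the last function need not be differentiable where
   [y = 0], monotonicity is derived from an almost everywhere bound on two-sided
   difference quotients. *)
Require Import Defs.
From mathcomp Require Import all_boot all_order all_algebra.
From mathcomp Require Import ring lra.
From mathcomp Require Import all_classical all_reals all_analysis.
From mathcomp Require Import measurable_realfun.

Set Implicit Arguments.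
Unset Strict Implicit.
Unset Printing Implicit Defensive.

Import Order.TTheory GRing.Theory Num.Theory.
Import numFieldNormedType.Exports.
Local Open Scope classical_set_scope.
Local Open Scope ring_scope.

(** * A monotonicity criterion for absolutely continuous functions *)

Section Monotonicity.
Context {R : realType}.

(** Let [s] be the supremum of the [x] in [[a, b]] with [P a x]. The local property at [s] starts
    from such an [x] close to [s], so it extends [P a] up to [s], and past it unless [s = b]. *)
Lemma cousin (a b : R) (P : R -> R -> Prop) : a <= b ->
  (forall u v w, u <= v -> v <= w -> P u v -> P v w -> P u w) ->
  (forall t, a <= t -> t <= b -> exists2 d, 0 < d & forall u v,
     a <= u -> u <= t -> t <= v -> v <= b -> t - d < u -> v < t + d -> P u v) ->
  P a b.
Proof.
move=> ab Ptrans Ploc.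
pose S := [set x | [/\ a <= x, x <= b & P a x]].
have Sa : S a.
  split=> //; have [d d0 Hd] := Ploc a (lexx _) ab; apply: Hd => //; lra.
have Sub : ubound S b by move=> x [].
have hasS : has_sup S by split; [exists a | exists b].
have as_ : a <= sup S by apply: ub_le_sup => //; exists b.
have sb : sup S <= b by apply: ge_sup => //; exists a.
have [d d0 Hd] := Ploc _ as_ sb.
have [x [ax xb Pax] sx] := sup_adherent d0 hasS.
have xs : x <= sup S by apply: ub_le_sup => //; exists b.
(* [y] lies beyond the supremum by half the radius, capped at [b]; membership of [y] in [S] then
   forces [y = b]. *)
pose y := Num.min b (sup S + d / 2).
have yb : y <= b by rewrite ge_min lexx.
have sy : sup S <= y by rewrite le_min sb /=; lra.
have yd : y < sup S + d.
  by rewrite gt_min; apply/orP; right; lra.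
have Pay : P a y.
  by apply: (Ptrans _ x) => //; [exact: le_trans sy | exact: Hd].
have Sy : S y by split=> //; exact: le_trans sy.
have : y <= sup S by apply: ub_le_sup => //; exists b.
rewrite ge_min => /orP[bs|]; last by lra.
by have -> : b = y by apply/eqP; rewrite eq_le yb (le_trans bs sy).
Qed.

(** Says that the upper limits of the difference quotients on both sides of [t] are at most 0.
    Multiplying by [(s - t) ^+ 2] avoids division and treats the two sides at once. *)
Definition nonincreasing_at (f : R -> R) (t : R) :=
  forall e : R, 0 < e ->
    \forall s \near t, (f s - f t) * (s - t) <= e * (s - t) ^+ 2.

(** By outer regularity, [U] exceeds a measurable null set [A] containing [N] by measure less than
    [d]. *)
Lemma null_set_open_cover (N : set R) (d : R) : 0 < d ->
  lebesgue_measure.-negligible N ->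
  exists U, [/\ open U, N `<=` U & (lebesgue_measure U < d%:E)%E].
Proof.
move=> d0 [A [mA A0 NA]].
have [|U [oU AU UA]] := lebesgue_regularity_outer mA _ d0.
  by apply: (@le_lt_trans _ _ 0%E); rewrite ?ltry// -A0.
exists U; split => //; first exact: subset_trans AU.
have mU : measurable U by exact: open_measurable.
apply: le_lt_trans UA.
have -> : U = A `|` (U `\` A) by rewrite setDUK.
apply: le_trans (measureU2 _ _ _) _ => //; first exact: measurableD.
by rewrite setDUK//; rewrite [X in (X + _)%E]A0 add0e.
Qed.

Lemma sum_length_le (U : set R) (m : R) n (s t : 'I_n -> R) :
  open U -> (lebesgue_measure U < m%:E)%E ->
  (forall i, s i <= t i) -> (forall i, `]s i, t i[%classic `<=` U) ->
  trivIset [set: 'I_n] (fun i => `]s i, t i[%classic) ->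
  \sum_(i < n) (t i - s i) < m.
Proof.
move=> oU Um st stU tr.
rewrite -lte_fin; apply: le_lt_trans Um.
have itvE i : lebesgue_measure `]s i, t i[%classic = (t i - s i)%:E.
  rewrite lebesgue_measure_itv/= lte_fin; case: ltP => // ts.
  by rewrite (_ : t i = s i) ?subrr //; apply/le_anti; rewrite ts st.
have mF : measurable (\big[setU/set0]_(i < n) `]s i, t i[%classic).
  by apply: bigsetU_measurable => i _.
have <- : lebesgue_measure (\big[setU/set0]_(i < n) `]s i, t i[%classic) =
    (\sum_(i < n) (t i - s i))%:E.
  rewrite measure_semi_additive_ord// -sumEFin; apply: eq_bigr => i _.
  exact: itvE.
apply: le_measure; rewrite ?inE //; first exact: open_measurable.
elim/big_ind: _ => [|A B AU BU|i _]; last exact: stU.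
  exact: sub0set.
by rewrite subUset.
Qed.

(** Lists, rather than indexed families, let chains over adjacent intervals be joined by
    concatenation. *)
Definition interval_chain (U : set R) (u v : R) (l : seq (R * R)) :=
  [/\ forall p, p \in l -> [/\ u <= p.1, p.1 <= p.2 & p.2 <= v],
      pairwise (fun p q => p.2 <= q.1) l &
      forall p, p \in l -> `]p.1, p.2[%classic `<=` U].

Lemma abs_continuous_chain (V : normedModType R) (a b : R) (f : R -> V) :
  abs_continuous a b f -> forall e, 0 < e -> exists2 d, 0 < d &
  forall U l, open U -> (lebesgue_measure U < d%:E)%E -> interval_chain U a b l ->
    \sum_(p <- l) `|f p.2 - f p.1| < e.
Proof.
move=> acf e e0; have [d d0 Hd] := acf e e0; exists d => // U l oU Ud [lab lp lU].
rewrite (big_nth (0, 0)) big_mkord.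
have lP (i : 'I_(size l)) : nth (0, 0) l i \in l by rewrite mem_nth.
have tr : trivIset [set: 'I_(size l)]
    (fun i => `](nth (0, 0) l i).1, (nth (0, 0) l i).2[%classic).
  apply/trivIsetP => i j _ _; wlog ij : i j / (i < j)%N.
    move=> W; rewrite neq_ltn => /orP[] ij; first by apply: W; rewrite // neq_ltn ij.
    by rewrite setIC; apply: W; rewrite // neq_ltn ij.
  move/(pairwiseP (0, 0)): (lp) => lpP _.
  have le := lpP _ _ (ltn_ord i) (ltn_ord j) ij.
  apply/seteqP; split=> // x [] /=; rewrite !in_itv/=; lra.
apply: Hd => //.
  by move=> i; have [? ? ?] := lab _ (lP i).
by apply: (sum_length_le oU Ud) => // i; [have [] := lab _ (lP i)|exact: lU].
Qed.

(* Cousin's lemma replaces Vitali's: near a point of the exceptional null set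
   the increment is charged to an interval inside an open set of small measure,
   elsewhere it is at most [e] times the length. *)
Lemma abs_continuous_nonincreasing (a b : R) (f : R -> R) : a <= b ->
  abs_continuous a b f ->
  {ae lebesgue_measure, forall t, a < t < b -> nonincreasing_at f t} ->
  f b <= f a.
Proof.
move=> ab acf aef.
suff H e : 0 < e -> f b - f a <= e * (b - a) + e.
  apply/ler_addgt0Pl => e e0.
  (* With [e / (b - a + 1)] in place of [e] the two error terms add up to exactly [e]; the 1 keeps
     the divisor positive when [a = b]. *)
  have D : 0 < b - a + 1 by lra.
  have := H (e / (b - a + 1)) (divr_gt0 e0 D).
  have -> : e / (b - a + 1) * (b - a) + e / (b - a + 1) = e.
    by field; apply: lt0r_neq0.
  lra.
move=> e0.
have [d d0 Hd] := abs_continuous_chain acf e0.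
(* The endpoints join the exceptional set, as the hypothesis speaks only of the open interval. *)
have Nab : lebesgue_measure.-negligible
   (~` [set t | a < t < b -> nonincreasing_at f t] `|` ([set a] `|` [set b])).
  apply: negligibleU => //; apply: negligibleU.
    by exists [set a]; split=> //; exact: lebesgue_measure_set1.
  by exists [set b]; split=> //; exact: lebesgue_measure_set1.
have [U [oU NU Ud]] := null_set_open_cover d0 Nab.
suff [l cl] : exists2 l, interval_chain U a b l &
    f b - f a <= e * (b - a) + \sum_(p <- l) `|f p.2 - f p.1|.
  by move=> /le_trans; apply; rewrite lerD2l ltW // (Hd U l).
apply: (@cousin a b (fun u v => exists2 l, interval_chain U u v l &
    f v - f u <= e * (v - u) + \sum_(p <- l) `|f p.2 - f p.1|)) => //.
  move=> u v w uv vw [l1 [l1b l1p l1U] H1] [l2 [l2b l2p l2U] H2].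
  exists (l1 ++ l2); last by rewrite big_cat/=; lra.
  split.
  - move=> p; rewrite mem_cat => /orP[/l1b[]|/l2b[]]; split; lra.
  - rewrite pairwise_cat l1p l2p !andbT; apply/allrelP => p q /l1b[_ _ pv] /l2b[vq _ _].
    exact: le_trans vq.
  - by move=> p; rewrite mem_cat => /orP[/l1U|/l2U].
move=> t at_ tb; have [Ut|Ut] := pselect (U t).
  have /nbhs_ballP[r /= r0 rU] : nbhs t U by exact: open_nbhs_nbhs.
  exists r => // u v au ut tv vb ru vr; exists [:: (u, v)].
    split=> //= [p|p]; rewrite inE => /eqP -> /=; first by split=> //; lra.
    move=> x; rewrite /= in_itv /= => /andP[ux xv]; apply: rU => /=.
    rewrite ball_itv/= in_itv /=; lra.
  rewrite big_seq1/=; have := ler_norm (f v - f u).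
  have : 0 <= e * (v - u) by apply: mulr_ge0; lra.
  lra.
have ft : nonincreasing_at f t.
  have ta : t != a by apply: contra_notN Ut => /eqP ->; apply: NU; right; left.
  have tb' : t != b by apply: contra_notN Ut => /eqP ->; apply: NU; right; right.
  apply: contrapT => nf; apply: Ut; apply: NU; left => /= K; apply/nf/K.
  by rewrite !lt_neqAle eq_sym ta at_ tb' tb.
have /nbhs_ballP[r /= r0 rU] := ft _ e0.
exists r => // u v au ut tv vb ru vr; exists [::]; first by split.
rewrite big_nil addr0.
(* The increment from [u] to [v] is cut at [t], since the local estimate compares only with the
   value at [t]. *)
have Hu : f t - f u <= e * (t - u).
  have [->|tu] := eqVneq u t; first by lra.
  have tu' : 0 < t - u by lra.
  rewrite -(ler_pM2r tu').
  have /rU/= : ball t r u by rewrite ball_itv/= in_itv/=; lra.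
  nra.
have Hv : f v - f t <= e * (v - t).
  have [->|tu] := eqVneq v t; first by lra.
  have tu' : 0 < v - t by lra.
  rewrite -(ler_pM2r tu').
  have /rU/= : ball t r v by rewrite ball_itv/= in_itv/=; lra.
  nra.
lra.
Qed.

End Monotonicity.

(** * Closure properties of absolute continuity *)

Section AbsContinuous.
Context {R : realType}.
Implicit Types (a b : R).

(** Both sums of increments are made smaller than [e / (2 * L)]. Sums, products, absolute values and
    coordinates are all reduced to this bound. *)
Lemma abs_continuous_dom (V W U : normedModType R) a b L
    (f : R -> V) (g : R -> W) (h : R -> U) : 0 < L ->
  abs_continuous a b f -> abs_continuous a b g ->
  (forall s t, a <= s -> s <= t -> t <= b ->
     `|h t - h s| <= L * (`|f t - f s| + `|g t - g s|)) ->
  abs_continuous a b h.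
Proof.
move=> L0 acf acg H e e0.
have e20 : 0 < e / (2 * L) by apply: divr_gt0 => //; lra.
have [df df0 Hf] := acf _ e20; have [dg dg0 Hg] := acg _ e20.
exists (Num.min df dg); first by rewrite lt_min df0.
move=> n s t st tr; rewrite lt_min => /andP[/(Hf _ _ _ st tr) F /(Hg _ _ _ st tr) G].
apply: (@le_lt_trans _ _
    (\sum_(i < n) L * (`|f (t i) - f (s i)| + `|g (t i) - g (s i)|))).
  by apply: ler_sum => i _; have [? [? ?]] := st i; apply: H.
rewrite -mulr_sumr big_split /=.
have -> : e = L * (e / (2 * L) + e / (2 * L)) by field; apply: lt0r_neq0.
by rewrite ltr_pM2l // ltrD.
Qed.

Lemma abs_continuousW (V : normedModType R) a b b' (f : R -> V) : b' <= b ->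
  abs_continuous a b f -> abs_continuous a b' f.
Proof.
move=> bb acf e /acf[d d0 Hd]; exists d => // n s t st; apply: Hd => i.
by have [? [? tb]] := st i; do !split => //; exact: le_trans bb.
Qed.

(** On intervals shorter than the [d] belonging to [e = 1], [f] moves by less than 1; local bounds
    are merged by taking maxima. Needed for products. *)
Lemma abs_continuous_bounded (V : normedModType R) a b (f : R -> V) : a <= b ->
  abs_continuous a b f ->
  exists M, forall t, a <= t -> t <= b -> `|f t| <= M.
Proof.
move=> ab acf.
have [d d0 Hd] := acf _ ltr01.
have loc s t : a <= s -> s <= t -> t <= b -> t - s < d -> `|f t - f s| < 1.
  move=> sa st tb td.
  have := Hd 1%N (fun=> s) (fun=> t); rewrite !big_ord1; apply => //.
  by apply/trivIsetP => i j _ _; rewrite !ord1.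
apply: (@cousin _ a b (fun u v =>
  exists M, forall t, u <= t -> t <= v -> `|f t| <= M)) => //.
  move=> u v w uv vw [M HM] [N HN]; exists (Num.max M N) => t ut tw.
  by rewrite le_max; have [/(HM _ ut)->//|/ltW/HN->] := leP t v; rewrite ?orbT.
move=> t at_ tb; exists d => // u v au ut tv vb du dv.
exists (`|f t| + 1) => x ux xv.
rewrite -lerBlDl; apply: le_trans (lerB_dist _ _) _.
have [xt|/ltW tx] := leP x t.
  by rewrite distrC ltW // loc //; lra.
by rewrite ltW // loc //; lra.
Qed.

Lemma abs_continuous_cst a b (k : R) : abs_continuous a b (fun=> k).
Proof.
move=> e e0; exists 1 => // n s t _ _ _.
by rewrite big1 // => i _; rewrite subrr normr0.
Qed.

Lemma abs_continuousD a b (f g : R -> R) :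
  abs_continuous a b f -> abs_continuous a b g ->
  abs_continuous a b (fun t => f t + g t).
Proof.
move=> acf acg; apply: (abs_continuous_dom ltr01 acf acg) => s t _ _ _.
rewrite mul1r; apply: le_trans (ler_normD _ _).
by rewrite le_eqVlt; apply/orP; left; apply/eqP; congr (`| _ |); ring.
Qed.

Lemma abs_continuousN a b (f : R -> R) :
  abs_continuous a b f -> abs_continuous a b (fun t => - f t).
Proof.
move=> acf; apply: (abs_continuous_dom ltr01 acf acf) => s t _ _ _.
by rewrite -opprD normrN mul1r lerDl.
Qed.

Lemma abs_continuous_norm a b (f : R -> R) :
  abs_continuous a b f -> abs_continuous a b (fun t => `|f t|).
Proof.
move=> acf; apply: (abs_continuous_dom ltr01 acf acf) => s t _ _ _.
by rewrite mul1r; apply: le_trans (ler_dist_dist _ _) _; rewrite lerDl.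
Qed.

Lemma abs_continuousM a b (f g : R -> R) : a <= b ->
  abs_continuous a b f -> abs_continuous a b g ->
  abs_continuous a b (fun t => f t * g t).
Proof.
move=> ab acf acg.
have [M HM] := abs_continuous_bounded ab acf.
have [N HN] := abs_continuous_bounded ab acg.
have M0 : 0 <= M by apply: le_trans (HM _ (lexx a) ab).
have N0 : 0 <= N by apply: le_trans (HN _ (lexx a) ab).
(* The increment of the product costs [N] for [f] and [M] for [g]; the 1 makes the constant
   positive. *)
have L0 : 0 < M + N + 1 by lra.
apply: (abs_continuous_dom L0 acf acg) => s t as_ st tb.
have -> : f t * g t - f s * g s = (f t - f s) * g s + f t * (g t - g s) by ring.
apply: le_trans (ler_normD _ _) _; rewrite !normrM.
have := HM _ (le_trans as_ st) tb; have := HN _ as_ (le_trans st tb).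
have := normr_ge0 (f t - f s); have := normr_ge0 (g t - g s).
have := normr_ge0 (f t); have := normr_ge0 (g s).
nra.
Qed.

Lemma abs_continuousX a b (f : R -> R) n : a <= b ->
  abs_continuous a b f -> abs_continuous a b (fun t => f t ^+ n).
Proof.
move=> ab acf; elim: n => [|n IH]; first exact: abs_continuous_cst.
have -> : (fun t => f t ^+ n.+1) = (fun t => f t * f t ^+ n).
  by apply/funext => t; rewrite exprS.
exact: abs_continuousM.
Qed.

End AbsContinuous.

(** * Difference quotient bounds from derivatives *)

Section Derive.
Context {R : realType}.
Implicit Types (f g h : R -> R) (t : R).

(** The quotients tend to [df <= 0], so they are below [e] near [t]. *)
Lemma is_derive_nonincreasing_at f t df :
  is_derive t 1 f df -> df <= 0 -> nonincreasing_at f t.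
Proof.
move=> [fd fE] df0 e e0.
have : h^-1 *: (f (h *: 1 + t) - f t) @[h --> 0^'] --> df by rewrite -fE; exact: fd.
move=> /cvgrPdist_lt /(_ e e0); rewrite /prop_near1 /= => /nbhs_ballP[r /= r0 rH].
apply/nbhs_ballP; exists r => //= s; rewrite ball_itv /= in_itv /= => sr.
have [->|st] := eqVneq s t; first by rewrite !subrr; lra.
have st0 : s - t != 0 by rewrite subr_eq0.
have := rH (s - t); rewrite ball_itv /= in_itv /=.
have -> : (s - t) *: 1 + t = s by rewrite /GRing.scale /=; ring.
move=> /(_ _ st0); rewrite distrC => H.
have {H}/ltW H : (s - t)^-1 * (f s - f t) < e.
  have /H : 0 - r < s - t < 0 + r by lra.
  by move=> /(le_lt_trans (ler_norm _)) /=; rewrite /GRing.scale /=; lra.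
have -> : (f s - f t) * (s - t) = (s - t)^-1 * (f s - f t) * (s - t) ^+ 2 by field.
by apply: ler_wpM2r => //; exact: sqr_ge0.
Qed.

(** Each nearby [s] uses the estimate of whichever piece gives [h s], the reference value at [t]
    being common. No differentiability of [h] is involved. *)
Lemma nonincreasing_at_glue f g h t :
  (\forall s \near t, h s = f s \/ h s = g s) -> h t = f t -> h t = g t ->
  nonincreasing_at f t -> nonincreasing_at g t -> nonincreasing_at h t.
Proof.
move=> hfg hf hg nf ng e e0; move: (nf e e0) (ng e e0) hfg.
by apply: filterS3 => s Hf Hg [] ->; [rewrite hf|rewrite hg].
Qed.

End Derive.

(** * Monotone quantities along horizontal curves *)

Section Horizontal.
Context {R : realType}.

Lemma ae_impl (P Q : R -> Prop) : (forall t, P t -> Q t) ->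
  {ae lebesgue_measure, forall t, P t} -> {ae lebesgue_measure, forall t, Q t}.
Proof. by move=> PQ; apply: negligibleS => t /= nQ /PQ. Qed.

Ltac ac_tac := repeat first
  [ assumption | apply: abs_continuousD | apply: abs_continuousN
  | apply: abs_continuousX => // | apply: abs_continuousM => //
  | apply: abs_continuous_norm | apply: abs_continuous_cst ].

(** The velocity is [u] times [engelX] plus [v] times [engelY], in coordinates; [u >= |v|] is split
    into two linear inequalities. *)
Definition horizontal_at (X Y Z W : R -> R) (t : R) := exists u v : R,
  [/\ 0 <= u + v, 0 <= u - v, is_derive t 1 X u, is_derive t 1 Y v &
      is_derive t 1 Z ((Y t * u - X t * v) / 2) /\
      is_derive t 1 W (Y t * (Y t * u - X t * v) / 2)].

Context (X Y Z W : R -> R) (a b : R).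
Context (ab : a <= b)
  (acX : abs_continuous a b X) (acY : abs_continuous a b Y)
  (acZ : abs_continuous a b Z) (acW : abs_continuous a b W)
  (X0 : X a = 0) (Y0 : Y a = 0) (Z0 : Z a = 0) (W0 : W a = 0)
  (hor : {ae lebesgue_measure, forall t, a < t < b -> horizontal_at X Y Z W t}).

(** Stated for every intermediate time, so that the cone condition becomes available along the whole
    curve and can sign the other derivatives. *)
Let nonpos_on_horizontal (f : R -> R) t : a <= t -> t <= b ->
  abs_continuous a b f -> f a = 0 ->
  (forall s, horizontal_at X Y Z W s -> nonincreasing_at f s) -> f t <= 0.
Proof.
move=> at_ tb acf fa H; rewrite -fa.
apply: abs_continuous_nonincreasing => //; first exact: abs_continuousW acf.
apply: ae_impl hor => s hs /andP[as_ st]; apply/H/hs.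
by rewrite as_ (lt_le_trans st).
Qed.

Lemma horizontal_cone t : a <= t -> t <= b -> 0 <= X t - Y t /\ 0 <= X t + Y t.
Proof.
move=> at_ tb.
have : - (X t - Y t) <= 0.
  apply: (nonpos_on_horizontal (f := fun t => - (X t - Y t))) => //; first by ac_tac.
    by rewrite X0 Y0 subrr oppr0.
  move=> s [u [v [uv uv' dX dY _]]].
  by apply: is_derive_nonincreasing_at; lra.
have : - (X t + Y t) <= 0.
  apply: (nonpos_on_horizontal (f := fun t => - (X t + Y t))) => //; first by ac_tac.
    by rewrite X0 Y0 addr0 oppr0.
  move=> s [u [v [uv uv' dX dY _]]].
  by apply: is_derive_nonincreasing_at; lra.
lra.
Qed.

Lemma nonpos_in_cone (f : R -> R) : abs_continuous a b f -> f a = 0 ->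
  (forall t, 0 <= X t - Y t -> 0 <= X t + Y t -> horizontal_at X Y Z W t ->
     nonincreasing_at f t) ->
  f b <= 0.
Proof.
move=> acf fa H; rewrite -fa; apply: abs_continuous_nonincreasing => //.
apply: ae_impl hor => t h atb; case/andP: (atb) => /ltW at_ /ltW tb.
by have [xy xy'] := horizontal_cone at_ tb; exact: (H t xy xy' (h atb)).
Qed.

Lemma f1_le0 : Z b - 1 / 4 * (X b ^+ 2 - Y b ^+ 2) <= 0.
Proof.
apply: (nonpos_in_cone (f := fun t => Z t - 1 / 4 * (X t ^+ 2 - Y t ^+ 2))).
- by ac_tac.
- by rewrite X0 Y0 Z0; ring.
move=> t xy xy' [u [v [uv uv' dX dY [dZ dW]]]].
apply: is_derive_nonincreasing_at; rewrite /GRing.scale /=.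
(* The derivative is [- 1 / 2] times this product. *)
have := mulr_ge0 xy uv; nra.
Qed.

Lemma f2_le0 : - Z b - 1 / 4 * (X b ^+ 2 - Y b ^+ 2) <= 0.
Proof.
apply: (nonpos_in_cone (f := fun t => - Z t - 1 / 4 * (X t ^+ 2 - Y t ^+ 2))).
- by ac_tac.
- by rewrite X0 Y0 Z0; ring.
move=> t xy xy' [u [v [uv uv' dX dY [dZ dW]]]].
apply: is_derive_nonincreasing_at; rewrite /GRing.scale /=.
have := mulr_ge0 xy' uv'; nra.
Qed.

Lemma g3_le0 : - W b - 1 / 4 * (X b * Y b ^+ 2 - Y b ^+ 3) <= 0.
Proof.
apply: (nonpos_in_cone (f := fun t => - W t - 1 / 4 * (X t * Y t ^+ 2 - Y t ^+ 3))).
- by ac_tac.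
- by rewrite X0 Y0 W0; ring.
move=> t xy xy' [u [v [uv uv' dX dY [dZ dW]]]].
apply: is_derive_nonincreasing_at; rewrite /GRing.scale /=.
(* The derivative is [- 3 / 4] times this product. *)
have := mulr_ge0 (sqr_ge0 (Y t)) uv'; nra.
Qed.

Lemma g4_le0 : - W b - 1 / 4 * (X b * Y b ^+ 2 + Y b ^+ 3) <= 0.
Proof.
apply: (nonpos_in_cone (f := fun t => - W t - 1 / 4 * (X t * Y t ^+ 2 + Y t ^+ 3))).
- by ac_tac.
- by rewrite X0 Y0 W0; ring.
move=> t xy xy' [u [v [uv uv' dX dY [dZ dW]]]].
apply: is_derive_nonincreasing_at; rewrite /GRing.scale /=.
have := mulr_ge0 (sqr_ge0 (Y t)) uv; nra.
Qed.

Let gup t := W t - 1 / 16 * (X t ^+ 2 - Y t ^+ 2) * (X t + 3 * Y t).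
Let gdown t := W t - 1 / 16 * (X t ^+ 2 - Y t ^+ 2) * (X t - 3 * Y t).

Let gup_nonincreasing_at t : 0 <= X t - Y t -> 0 <= X t + Y t -> 0 <= Y t ->
  horizontal_at X Y Z W t -> nonincreasing_at gup t.
Proof.
move=> xy xy' y0 [u [v [uv uv' dX dY [dZ dW]]]].
apply: is_derive_nonincreasing_at; rewrite /GRing.scale /=.
(* This is where the sign of [Y t] enters; the derivative is [- 3 / 16] times the product formed
   next. *)
have xy3 : 0 <= X t + 3 * Y t by lra.
have := mulr_ge0 uv (mulr_ge0 xy xy3); nra.
Qed.

Let gdown_nonincreasing_at t : 0 <= X t - Y t -> 0 <= X t + Y t -> Y t <= 0 ->
  horizontal_at X Y Z W t -> nonincreasing_at gdown t.
Proof.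
move=> xy xy' y0 [u [v [uv uv' dX dY [dZ dW]]]].
apply: is_derive_nonincreasing_at; rewrite /GRing.scale /=.
have xy3 : 0 <= X t - 3 * Y t by lra.
have := mulr_ge0 uv' (mulr_ge0 xy' xy3); nra.
Qed.

(** The curve may cross [y = 0] infinitely often, so [gup] and [gdown] are merged into one function
    followed from [a] to [b]. *)
Lemma g1_g2_le0 :
  W b - 1 / 16 * (X b ^+ 2 - Y b ^+ 2) * (X b + 3 * `|Y b|) <= 0.
Proof.
pose h t := W t - 1 / 16 * (X t ^+ 2 - Y t ^+ 2) * (X t + 3 * `|Y t|).
have hup t : 0 <= Y t -> h t = gup t by rewrite /h => /ger0_norm ->.
have hdown t : Y t <= 0 -> h t = gdown t.
  by rewrite /h => /ler0_norm ->; rewrite /gdown; ring.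
apply: (nonpos_in_cone (f := h)).
- by rewrite /h; ac_tac.
- by rewrite /h X0 Y0 W0; ring.
move=> t xy xy' ht.
have contY : {for t, continuous Y}.
  case: (ht) => u [v [_ _ _ dY _]].
  by apply/differentiable_continuous/derivable1_diffP; case: dY.
have [y0|y0|y0] := ltrgtP (Y t) 0.
- have gt : nonincreasing_at gdown t by apply: gdown_nonincreasing_at => //; exact: ltW.
  (* Gluing a function with itself transfers the property along equality near [t], which holds since
     [Y] keeps its sign there. *)
  apply: (nonincreasing_at_glue (f := gdown) (g := gdown)) => //;
    try exact: hdown (ltW y0).
  by apply: filterS (cvgr_lt _ contY _ y0) => s /ltW /hdown; left.
- have gt : nonincreasing_at gup t by apply: gup_nonincreasing_at => //; exact: ltW.
  apply: (nonincreasing_at_glue (f := gup) (g := gup)) => //;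
    try exact: hup (ltW y0).
  by apply: filterS (cvgr_gt _ contY _ y0) => s /ltW /hup; left.
(* At [Y t = 0] both pieces take the value [h t] and both sign conditions hold. *)
apply: (nonincreasing_at_glue (f := gup) (g := gdown)).
- apply: (filterS _ (@filterT _ (nbhs t) _)) => s _.
  by have [/hup|/ltW/hdown] := leP 0 (Y s); [left|right].
- by rewrite hup ?y0.
- by rewrite hdown ?y0.
- by apply: gup_nonincreasing_at; rewrite // y0.
- by apply: gdown_nonincreasing_at; rewrite // y0.
Qed.

End Horizontal.

(** * Points reachable from the origin *)

Lemma horizontal_coordinates (R : realType) (c : R -> 'rV[R]_4) (t : R) :
  [/\ derivable c t 1, nonspacelike (c t) ('D_1 c t) &
     future_directed (c t) ('D_1 c t)] ->
  horizontal_at (cx \o c) (cy \o c) (cz \o c) (cw \o c) t.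
Proof.
move=> [dc [[u [v cE]] + _]]; rewrite /future_directed cE engelgE.
(* Pairing with [engelX] gives [- u < 0]; with [v ^+ 2 <= u ^+ 2] from the nonspacelike condition
   this yields [|v| <= u]. *)
have := engelgE (c t) u v 1 0; rewrite scale1r scale0r addr0 => -> uv u0.
have dci i : is_derive t 1 (fun s => c s 0 i)
    ((u *: engelX (c t) + v *: engelY (c t)) 0 i).
  split; first by have /derivable_mxP := dc; apply.
  by rewrite -cE derive_mx// mxE.
have uv' : `|v| <= u.
  by rewrite -ler_sqr ?nnegrE ?real_normK ?num_real//; nra.
move: uv'; rewrite ler_norml => /andP[uv1 uv2].
exists u, v; split; [lra|lra| | |split].
- by apply: is_derive_eq (dci 0) _; rewrite !mxE /=; ring.
- by apply: is_derive_eq (dci 1) _; rewrite !mxE /=; ring.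
- by apply: is_derive_eq (dci 2) _; rewrite !mxE /= /cx /cy; field.
- by apply: is_derive_eq (dci 3) _; rewrite !mxE /= /cx /cy; field.
Qed.

(** The norm on row vectors is the maximum of the absolute values of the entries. *)
Lemma abs_continuous_coord (R : realType) (a b : R) n (c : R -> 'rV[R]_n) i :
  abs_continuous a b c -> abs_continuous a b (fun t => c t 0 i).
Proof.
move=> acc; apply: (abs_continuous_dom ltr01 acc acc) => s t _ _ _.
rewrite mul1r; apply: (@le_trans _ _ `|c t - c s|); last by rewrite lerDl.
have -> : c t 0 i - c s 0 i = (c t - c s) 0 i by rewrite !mxE.
rewrite [leRHS]/Num.Def.normr /= mx_normrE.
by apply/bigmax_geP; right; exists (0, i).
Qed.

Lemma Jplus_ineqs (R : realType) (q : 'rV[R]_4) : Jplus 0 q ->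
  [/\ f1 q <= 0, f2 q <= 0, g3 q <= 0, g4 q <= 0 &
  [/\ cw q - 1 / 16 * (cx q ^+ 2 - cy q ^+ 2) * (cx q + 3 * `|cy q|) <= 0,
      0 <= cx q - cy q & 0 <= cx q + cy q]].
Proof.
case=> [->|[a [b [c [ab [acc hc] ca cb]]]]].
  rewrite /f1 /f2 /g3 /g4 /cx /cy /cz /cw !mxE normr0.
  by split; [..|split]; lra.
have hor : {ae lebesgue_measure, forall t, a < t < b ->
    horizontal_at (cx \o c) (cy \o c) (cz \o c) (cw \o c) t}.
  by apply: ae_impl hc => t H /H; exact: horizontal_coordinates.
have acx : abs_continuous a b (cx \o c) by exact: abs_continuous_coord.
have acy : abs_continuous a b (cy \o c) by exact: abs_continuous_coord.
have acz : abs_continuous a b (cz \o c) by exact: abs_continuous_coord.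
have acw : abs_continuous a b (cw \o c) by exact: abs_continuous_coord.
have x0 : (cx \o c) a = 0 by rewrite /= ca /cx mxE.
have y0 : (cy \o c) a = 0 by rewrite /= ca /cy mxE.
have z0 : (cz \o c) a = 0 by rewrite /= ca /cz mxE.
have w0 : (cw \o c) a = 0 by rewrite /= ca /cw mxE.
have ab' := ltW ab.
have [xy xy'] := horizontal_cone acx acy x0 y0 hor ab' (lexx b).
have F1 := f1_le0 ab' acx acy acz x0 y0 z0 hor.
have F2 := f2_le0 ab' acx acy acz x0 y0 z0 hor.
have G3 := g3_le0 ab' acx acy acw x0 y0 w0 hor.
have G4 := g4_le0 ab' acx acy acw x0 y0 w0 hor.
have G12 := g1_g2_le0 ab' acx acy acw x0 y0 w0 hor.
by move: xy xy' F1 F2 G3 G4 G12; rewrite /= cb.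
Qed.

Theorem proposition3p2 (R : realType) :
  Jplus (0 : 'rV[R]_4) `<=`
    (A11 `|` A12 `|` A13 `|` A14) `|` (A21 `|` A22 `|` A23 `|` A24).
Proof.
move=> q /Jplus_ineqs[F1 F2 G3 G4 [G12 xy xy']].
have x0 : 0 <= cx q by lra.
have G1 : 0 <= cy q -> g1 q <= 0 by move=> y0; move: G12; rewrite ger0_norm.
have G2 : cy q <= 0 -> g2 q <= 0.
  by move=> y0; move: G12; rewrite ler0_norm // mulrN.
(* The sign of [z] selects the first index, those of [y] and [w] the second; the goals come in the
   order [A11], [A13], [A12], [A14], then [A21], [A23], [A22], [A24]. *)
have [z0|/ltW z0] := leP 0 (cz q); [left|right];
  have [y0|/ltW y0] := leP 0 (cy q); have [w0|/ltW w0] := leP 0 (cw q).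
- by do 3 left; split; rewrite ?G1.
- by left; right; split.
- by do 2 left; right; split; rewrite ?G2.
- by right; split.
- by do 3 left; split; rewrite ?G1.
- by left; right; split.
- by do 2 left; right; split; rewrite ?G2.
- by right; split.
Qed.
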